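(* For every integer $n\geqslant 3$, the orbit number of the $n$-dimensional crossed cube satisfies $\text{Orb}(\text{CQ}_n)=2^{\lceil n/2\rceil-2}$.
   Context: Two 2-bit strings $x_2x_1$ and $y_2y_1$ are pair related, written $x_2x_1\sim y_2y_1$, iff $(x_2x_1,y_2y_1)\in\{(00,00),(10,10),(01,11),(11,01)\}$. The $n$-dimensional crossed cube $\text{CQ}_n$ has as vertices all binary strings $u=u_{n-1}\ldots u_0$ of length $n$. Two vertices $u,v$ are adjacent iff there is an index $x$ with $0\leqslant x\leqslant n-1$ such that: (1) $v_x\neq u_x$; (2) if $x$ is odd, $v_{x-1}=u_{x-1}$; (3) $v_i=u_i$ for all $i>x$; (4) $u_{2i+1}u_{2i}\sim v_{2i+1}v_{2i}$ for all $0\leqslant i\leqslant\lfloor x/2\rfloor-1$. An orbit of a graph $G$ is an orbit of the action of its automorphism group on $V(G)$ (a maximal set of vertices any two of which are mapped to each other by some automorphism), and $\text{Orb}(G)$ is the number of such orbits. *)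

(* Defs.v *)
From HB Require Import structures.
From mathcomp Require Import all_boot all_fingroup.

Set Implicit Arguments.
Unset Strict Implicit.
Unset Printing Implicit Defensive.

Import GroupScope.
Local Open Scope nat_scope.

Section GraphOrbits.

Variables (T : finType) (e : rel T).

Definition graph_aut : {set {perm T}} :=
  [set s : {perm T} | [forall u, forall v, e (s u) (s v) == e u v]].

Lemma graph_autP (s : {perm T}) :
  reflect (forall u v, e (s u) (s v) = e u v) (s \in graph_aut).
Proof.
rewrite inE; apply: (iffP forallP) => [H u v | H u].
  by apply/eqP; move/forallP: (H u); apply.
by apply/forallP => v; apply/eqP.
Qed.

Fact graph_aut_group_set : group_set graph_aut.
Proof.
apply/group_setP; split; first by apply/graph_autP => u v; rewrite !perm1.
move=> s t /graph_autP Hs /graph_autP Ht.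
by apply/graph_autP => u v; rewrite !permM Ht Hs.
Qed.

Canonical graph_aut_group : {group {perm T}} := Group graph_aut_group_set.

Definition Orb : nat := #|orbit 'P graph_aut @: [set: T]|.

End GraphOrbits.

(* The two-bit string x2x1 is the pair (x2, x1). *)
Definition pair_related : rel (bool * bool) := fun p q =>
  (p, q) \in [:: ((false, false), (false, false));
                 ((true,  false), (true,  false));
                 ((false, true),  (true,  true));
                 ((true,  true),  (false, true))].

(* The string u_{n-1} ... u_0 is stored least significant bit first, so that
   u_i is the i-th item of the tuple.  The default value of nth is never used
   by CQ, which reads only positions below n. *)
Definition bit (n : nat) (u : n.-tuple bool) (i : nat) : bool := nth false u i.

(* For x <= 1 the range i <= floor(x/2) - 1 of the last condition is empty;
   this is the reason for i < x./2, free of truncated subtraction. *)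
Definition CQ (n : nat) : rel (n.-tuple bool) := fun u v =>
  [exists x : 'I_n,
    [&& bit v x != bit u x,
        odd x ==> (bit v x.-1 == bit u x.-1),
        [forall i : 'I_n, (x < i) ==> (bit v i == bit u i)]
      & [forall i : 'I_(x./2),
          pair_related (bit u i.*2.+1, bit u i.*2)
                       (bit v i.*2.+1, bit v i.*2)]]].

Lemma pair_relatedC : symmetric pair_related.
Proof. by do 2![case=> [] [] []]. Qed.

Lemma CQ_sym (n : nat) : symmetric (@CQ n).
Proof.
move=> u v; apply: eq_existsb => x; rewrite eq_sym [bit v _.-1 == _]eq_sym.
congr [&& _, _, _ & _]; apply: eq_forallb => i; first by rewrite eq_sym.
exact: pair_relatedC.
Qed.

Lemma CQ_irrefl (n : nat) : irreflexive (@CQ n).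
Proof. by move=> u; apply/existsP => -[x /and4P[]]; rewrite eqxx. Qed.

(* Main.v *)
Require Import Defs.
From mathcomp Require Import all_boot all_fingroup.
From mathcomp Require Import zify.

(* Every vertex has exactly one neighbor along each dimension x < n.  Two
   neighbors of u, along x < y, have a common neighbor besides u iff x and y
   flip bits of the same pair or x is odd; this does not depend on u.  Hence an
   automorphism permutes the dimensions at u preserving this threshold graph,
   and peeling off the dimensions from the bottom shows that those below 2j+2
   are fixed as soon as 2j+4 < n.  If bit 2j of u is set, then u lies on a closed
   walk of length six using dimension 2j+1 once and otherwise five dimensions
   at least 2j+2.  So does its image; each of the five adds bit 2j to bit 2j+1,
   so that bit 2j of the image is set too.  Thus the bits 2j with 2j+4 < n are
   invariant; conversely, the automorphisms shear below act transitively on the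
   vertices for which these bits are prescribed. *)

Section CrossedCube.

Variable n : nat.
Implicit Types (u v w : n.-tuple bool) (x y z i : nat).

(** * Bits of vertices and the neighbor along each dimension *)

Lemma bit_inj u v : bit u =1 bit v -> u = v.
Proof.
move=> uv; apply: eq_from_tnth => i.
by rewrite !(tnth_nth false); apply: uv.
Qed.

Lemma bit_default u i : n <= i -> bit u i = false.
Proof. by move=> ni; rewrite /bit nth_default ?size_tuple. Qed.

Definition vertex (f : nat -> bool) : n.-tuple bool := [tuple f i | i < n].

Lemma bit_vertex f i : i < n -> bit (vertex f) i = f i.
Proof. by move=> lt_in; rewrite /bit -(tnth_nth _ _ (Ordinal lt_in)) tnth_mktuple. Qed.

(** [pair_related] is the graph of the involution adding the low bit of a pair to its high bit. The
    last summand applies it to every pair below that of [x]. *)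
Definition neighbor x u : n.-tuple bool :=
  vertex (fun i => bit u i (+) (i == x) (+)
                   (odd i && (i./2 < x./2) && bit u i.-1)).

Lemma bit_neighbor x u i : x < n ->
  bit (neighbor x u) i =
  bit u i (+) (i == x) (+) (odd i && (i./2 < x./2) && bit u i.-1).
Proof.
move=> xn; case: (ltnP i n) => [|ni]; first exact: bit_vertex.
rewrite !(bit_default _ _ ni).
have -> : (i == x) = false by lia.
have -> : (i./2 < x./2) = false by lia.
by rewrite andbF.
Qed.

Lemma CQP u v : reflect (exists2 x, x < n & v = neighbor x u) (CQ u v).
Proof.
apply: (iffP existsP) => [[x /and4P[/eqP vx]]|[x xn ->]].
  move=> /implyP vx1 /forallP hi /forallP lo; exists (x : nat); first exact: ltn_ord.
  apply: bit_inj => i; rewrite bit_neighbor //.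
  case: (ltngtP i x) => [ix|xi|->]; last first.
  - by rewrite ltnn andbF addbF; move: vx; case: bit; case: bit.
  - have -> : (i./2 < x./2) = false by lia.
    rewrite andbF !addbF.
    case: (ltnP i n) => [lt_in|ni]; last by rewrite !(bit_default _ _ ni).
    by move/implyP: (hi (Ordinal lt_in)) => /(_ xi) /eqP.
  rewrite addbF; case: (ltnP i./2 x./2) => ix2; last first.
    rewrite andbF addbF.
    have [ox ->] : odd x /\ i = x.-1 by lia.
    by apply/eqP/vx1.
  have := lo (Ordinal ix2); rewrite /pair_related /=.
  rewrite -[in bit v i](odd_double_half i) -[in bit u i](odd_double_half i).
  rewrite andbT -[in bit u i.-1](odd_double_half i).
  by case: (odd i) => /=; rewrite ?add1n ?add0n /=; do 4!case: bit.
exists (Ordinal xn); apply/and4P; split => /=.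
- rewrite bit_neighbor // eqxx ltnn andbF addbF.
  by case: bit.
- apply/implyP=> ox; rewrite bit_neighbor //.
  have -> : (x.-1 == x) = false by lia.
  have -> : odd x.-1 = false by lia.
  by rewrite !addbF.
- apply/forallP=> i; apply/implyP=> xi; rewrite bit_neighbor //.
  have -> : (i == x :> nat) = false by lia.
  have -> : (i./2 < x./2) = false by lia.
  by rewrite andbF !addbF.
apply/forallP=> i; rewrite !bit_neighbor //.
have ix := ltn_ord i.
have -> : (i.*2.+1 == x) = false by lia.
have -> : (i.*2 == x) = false by lia.
have -> : odd i.*2.+1 by lia.
have -> : odd i.*2 = false by lia.
have -> : i.*2.+1./2 < x./2 by lia.
by rewrite /= !addbF; case: bit; case: bit.
Qed.

Lemma neighborK x : x < n -> involutive (neighbor x).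
Proof.
move=> xn u; apply: bit_inj => i; rewrite !bit_neighbor //.
case: (boolP (odd i)) => oi /=; last by case: bit; case: eqP.
have -> : odd i.-1 = false by lia.
case: ltnP => ix /=; last by case: bit; case: eqP.
have -> : (i.-1 == x) = false by lia.
by rewrite !addbF; case: bit; case: bit; case: eqP.
Qed.

Lemma neighbor_inj u x y :
  x < n -> y < n -> neighbor x u = neighbor y u -> x = y.
Proof.
wlog xy : x y / x <= y => [H|] xn yn e.
  by case: (leqP x y) => [|/ltnW] xy; [|symmetry]; apply: H.
apply/eqP; rewrite eqn_leq xy leqNgt; apply/negP=> lt_xy.
have := congr1 (fun w => bit w y) e; rewrite !bit_neighbor // eqxx ltnn.
have -> : (y == x) = false by lia.
have -> : (y./2 < x./2) = false by lia.
by rewrite andbF !addbF; case: bit.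
Qed.

(** * Commuting dimensions and squares *)

Definition square_dims x y := (x./2 == y./2) || odd (minn x y).

Lemma square_dimsC x y : square_dims x y = square_dims y x.
Proof. by rewrite /square_dims minnC eq_sym. Qed.

(** A step reads only even positions in pairs below its own. It therefore notices neither a flip at
    an odd position nor one in its own pair. *)
Lemma neighborC x y u : x < n -> y < n -> square_dims x y ->
  neighbor x (neighbor y u) = neighbor y (neighbor x u).
Proof.
move=> xn yn c; apply: bit_inj => i; rewrite !bit_neighbor //.
case: (boolP (odd i)) => oi /=; last by case: bit; case: eqP; case: eqP.
have -> : odd i.-1 = false by lia.
rewrite /= !addbF.
have -> : (i./2 < x./2) && (bit u i.-1 (+) (i.-1 == y)) =
          (i./2 < x./2) && bit u i.-1.
  case: ltnP => //= ix.
  have -> : (i.-1 == y) = false by move: c; rewrite /square_dims; lia.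
  by rewrite addbF.
have -> : (i./2 < y./2) && (bit u i.-1 (+) (i.-1 == x)) =
          (i./2 < y./2) && bit u i.-1.
  case: ltnP => //= iy.
  have -> : (i.-1 == x) = false by move: c; rewrite /square_dims; lia.
  by rewrite addbF.
by case: bit; case: eqP; case: eqP; do 2!case: (_ && _).
Qed.

(** Position [x] forces [w = x]. Bit [x.+1] then receives bit [x] after its flip on the left and
    before it on the right. *)
Lemma no_square (x y z w : nat) u : x < n -> y < n -> z < n -> w < n ->
  x < y -> ~~ square_dims x y -> z != x ->
  neighbor z (neighbor x u) <> neighbor w (neighbor y u).
Proof.
move=> xn yn zn wn xy nc zx e.
have ex : ~~ odd x by move: nc; rewrite /square_dims; lia.
have hxy : x./2 < y./2 by move: nc; rewrite /square_dims; lia.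
have ev i : ~~ odd i -> (i == x) (+) (i == z) = (i == y) (+) (i == w).
  move=> /negbTE oi; have := congr1 (fun v => bit v i) e.
  rewrite !bit_neighbor // oi /= !addbF -!addbA.
  exact: addbI.
have wx : w = x by have := ev x ex; lia.
rewrite {}wx in ev e wn.
(* The step along [z] must act on the pair of [x]. For even [y] position [y] gives [z = y]; for odd
   [y] bit [y] has to change on the left too. *)
have yz : y./2 <= z./2.
  case: (boolP (odd y)) => oy; last by have := ev _ oy; lia.
  have oz : odd z by apply/negPn/negP=> oz; have := ev _ oz; lia.
  have := congr1 (fun v => bit v y) e.
  rewrite !bit_neighbor // eqxx oy ltnn.
  have -> : (y == x) = false by lia.
  have -> : (y./2 < x./2) = false by lia.
  rewrite /= !addbF.
  case: (ltngtP y./2 z./2) => //= h.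
  have -> : (y == z) = false by lia.
  by case: bit.
have := congr1 (fun v => bit v x.+1) e.
rewrite !bit_neighbor // /= eqxx.
have -> : (x.+1 == x) = false by lia.
have -> : odd x = false by lia.
have -> : (x == y) = false by lia.
have -> : uphalf x < z./2 by lia.
have -> : uphalf x < y./2 by lia.
have -> : uphalf x < x./2 = false by lia.
have -> : (x.+1 == y) = false by move: nc; rewrite /square_dims; lia.
have -> : (x.+1 == z) = false by lia.
by rewrite /=; case: bit; case: bit.
Qed.

(** The right side speaks of adjacency only, so automorphisms preserve [square_dims]. *)
Lemma squareP u x y : x < n -> y < n -> x != y ->
  reflect (exists v, [/\ v != u, CQ (neighbor x u) v & CQ (neighbor y u) v])
          (square_dims x y).
Proof.
move=> xn yn xy; apply: (iffP idP) => [c|].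
  exists (neighbor y (neighbor x u)); split.
  - apply: contraNneq xy => e; apply/eqP/(neighbor_inj u) => //.
    by rewrite -[LHS](neighborK y) // e.
  - by apply/CQP; exists y.
  by apply/CQP; exists x => //; rewrite neighborC // square_dimsC.
case=> v [vu /CQP[z zn ez] /CQP[w wn ew]].
have zx : z != x by apply: contraNneq vu => zx; rewrite ez zx neighborK.
have wy : w != y by apply: contraNneq vu => wy; rewrite ew wy neighborK.
apply/negPn/negP=> nc; case: (ltngtP x y) xy => // [lt|lt] _.
  by apply: (@no_square x y z w u) => //; rewrite -ez.
by apply: (@no_square y x w z u) => //; rewrite 1?square_dimsC // -ew.
Qed.

(** * Rigidity of the low dimensions *)

(* Among the dimensions at least 2k, only 2k+1 forms a square with all others,
   and, if k is small enough, only 2k forms a square with none except 2k+1. *)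
Lemma square_dims_rigid (f : 'I_n -> 'I_n) k (x : 'I_n) :
  injective f ->
  (forall y z : 'I_n, square_dims (f y) (f z) = square_dims y z) ->
  k.*2 + 2 < n -> x < k.*2 -> f x = x.
Proof.
move=> injf cf; elim: k x => [|k IHk] x kn xk; first by lia.
have {}IHk (z : 'I_n) : z < k.*2 -> f z = z by apply: IHk; lia.
have an : k.*2 < n by lia.
have bn : k.*2.+1 < n by lia.
pose a := Ordinal an; pose b := Ordinal bn.
(* As [f] fixes the dimensions below [k.*2], it permutes the others. *)
have surjf (z : 'I_n) : k.*2 <= z -> exists2 w : 'I_n, k.*2 <= w & f w = z.
  move=> kz; exists (invF injf z); last exact: f_invF.
  rewrite leqNgt; apply/negP=> lt.
  by move: (IHk _ lt); rewrite f_invF => e; move: lt; rewrite -e; lia.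
have high (z : 'I_n) : k.*2 <= z -> k.*2 <= f z.
  by move=> kz; rewrite leqNgt; apply/negP=> lt; have e := injf _ _ (IHk _ lt); move: lt; rewrite e; lia.
have fb : f b = b.
  have sq (w : 'I_n) : k.*2 <= w -> square_dims (f b) w.
    move=> /surjf[w' kw' <-]; rewrite cf /square_dims /=; lia.
  (* Squares with [k.*2] and [k.*2 + 2] already single out [k.*2.+1]. *)
  have c2n : k.*2 + 2 < n by lia.
  have := high b (leqnSn _); have := sq a (leqnn _).
  have /= := sq (Ordinal c2n) (leq_addr _ _).
  rewrite /square_dims /= => h1 h2 h3; apply: val_inj => /=; lia.
have fa : f a = a.
  have nsq (w : 'I_n) : k.*2 + 2 <= w -> w != f a -> ~~ square_dims (f a) w.
    move=> kw wa; have /surjf[w' kw' fw'] : k.*2 <= w by lia.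
    have w'a : w' != a by apply: contraNneq wa => <-; rewrite fw'.
    have w'b : w' != b by apply: contraTneq kw => e; rewrite -fw' e fb /=; lia.
    rewrite -fw' cf /square_dims; move: w'a w'b; rewrite -!val_eqE /=; lia.
  have fab : f a != b by rewrite -fb (inj_eq injf) -val_eqE /=; lia.
  have := high a (leqnn _) => kfa.
  apply/eqP/negPn/negP; rewrite -val_eqE /= => fa.
  rewrite -val_eqE /= in fab; have fan := ltn_ord (f a).
  (* A dimension forming a forbidden square with [f a]: its partner if [f a] is odd, [k.*2 + 3] if
     it is even. *)
  have wn : (if odd (f a) then (f a).-1 else k.*2 + 3) < n by case: ifP; lia.
  have := nsq (Ordinal wn); rewrite -val_eqE /square_dims /=.
  case: ifP => ofa; lia.
have [xa|xa] := eqVneq x a; first by rewrite xa.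
have [xb|xb] := eqVneq x b; first by rewrite xb.
by apply: IHk; move: xa xb; rewrite -!val_eqE /=; lia.
Qed.

(** The map [f] depends on [u]. Squares are carried over by [s] and back by its inverse. *)
Lemma aut_neighbor (s : {perm n.-tuple bool}) u : s \in graph_aut (@CQ n) ->
  exists f : 'I_n -> 'I_n, [/\ injective f,
    forall x y : 'I_n, square_dims (f x) (f y) = square_dims x y
    & forall x : 'I_n, s (neighbor x u) = neighbor (f x) (s u)].
Proof.
move=> /graph_autP sP.
have /fin_all_exists[f fE] (x : 'I_n) :
    exists y : 'I_n, s (neighbor x u) = neighbor y (s u).
  have /CQP[y yn e] : CQ (s u) (s (neighbor x u)).
    by rewrite sP; apply/CQP; exists (x : nat).
  by exists (Ordinal yn).
have injf : injective f.
  move=> x y e; apply: val_inj; apply: (neighbor_inj u); try exact: ltn_ord.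
  by apply: (@perm_inj _ s); rewrite [LHS]fE [RHS]fE e.
exists f; split=> // x y; have [->|xy] := eqVneq x y.
  by rewrite /square_dims !eqxx.
apply/(squareP (s u))/(squareP u); rewrite ?val_eqE ?(inj_eq injf) ?ltn_ord // -!fE.
  case=> v [vu vx vy]; exists (s^-1%g v).
  rewrite -(inj_eq (@perm_inj _ s)) permKV vu.
  by split=> //; rewrite -sP permKV.
case=> v [vu vx vy]; exists (s v).
by rewrite (inj_eq (@perm_inj _ s)) !sP.
Qed.

(** * Invariance of the low even bits *)

Lemma bit_neighbor_even x u k : x < n ->
  bit (neighbor x u) k.*2 = bit u k.*2 (+) (k.*2 == x).
Proof. by move=> xn; rewrite bit_neighbor // odd_double addbF. Qed.

Lemma bit_neighbor_odd x u k : x < n ->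
  bit (neighbor x u) k.*2.+1 =
  bit u k.*2.+1 (+) (k.*2.+1 == x) (+) ((k < x./2) && bit u k.*2).
Proof.
by move=> xn; rewrite bit_neighbor //= odd_double uphalf_double.
Qed.

(* The five dimensions other than 2j+1 are at least 2j+2: their number being
   odd, the walk closes only if bit 2j is set. *)
Lemma hexagon u j : j.*2 + 4 < n -> bit u j.*2 ->
  neighbor (j.*2 + 3) (neighbor (j.*2 + 1) (neighbor (j.*2 + 2)
    (neighbor (j.*2 + 4) (neighbor (j.*2 + 2) (neighbor (j.*2 + 4) u))))) = u.
Proof.
move=> n4 uj; have n3 : j.*2 + 3 < n by lia.
have n2 : j.*2 + 2 < n by lia.
have n1 : j.*2 + 1 < n by lia.
apply: bit_inj => i; rewrite -(odd_double_half i); move: (i./2) => k.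
have -> : odd i + k.*2 = if odd i then k.*2.+1 else k.*2 by case: odd.
have e1 : (k.*2 == j.*2 + 1) = false by lia.
have e2 : (k.*2 == j.*2 + 2) = (k == j.+1) by lia.
have e3 : (k.*2 == j.*2 + 3) = false by lia.
have e4 : (k.*2 == j.*2 + 4) = (k == j.+2) by lia.
case: odd; rewrite ?bit_neighbor_odd // !bit_neighbor_even // ?e1 ?e2 ?e3 ?e4; last first.
  by case: eqP; case: eqP; case: bit.
have -> : (k.*2.+1 == j.*2 + 1) = (k == j) by lia.
have -> : (k.*2.+1 == j.*2 + 2) = false by lia.
have -> : (k.*2.+1 == j.*2 + 3) = (k == j.+1) by lia.
have -> : (k.*2.+1 == j.*2 + 4) = false by lia.
have -> : (j.*2 + 1)./2 = j by lia.
have -> : (j.*2 + 2)./2 = j.+1 by lia.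
have -> : (j.*2 + 3)./2 = j.+1 by lia.
have -> : (j.*2 + 4)./2 = j.+2 by lia.
have [kj|kj|->] := ltngtP k j; last 1 first.
(* At [k = j], five copies of the set bit [j.*2] cancel the flip along [j.*2 + 1]. *)
- have -> : (j == j.+1) = false by lia.
  have -> : (j == j.+2) = false by lia.
  by rewrite !ltnS leqnn leqnSn uj; case: bit.
- have -> : (k == j.+1) = false by lia.
  have -> : (k == j.+2) = false by lia.
  have -> : k < j.+1 by lia.
  have -> : k < j.+2 by lia.
  by case: bit; case: bit.
have -> : (k < j.+1) = false by lia.
have -> : (k < j.+2) = (k == j.+1) by lia.
(* The two steps along [j.*2 + 4] add bit [j.*2 + 2] before and after a flip, in total 1; the step
   along [j.*2 + 3] cancels this. *)
case: (eqVneq k j.+1) => [->|_]; last by rewrite !addbF.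
have -> : (j.+1 == j.+2) = false by lia.
by case: bit; case: bit.
Qed.

Lemma aut_bit (s : {perm n.-tuple bool}) u j : s \in graph_aut (@CQ n) ->
  j.*2 + 4 < n -> bit u j.*2 -> bit (s u) j.*2.
Proof.
move=> sP jn uj.
have step v x : x < n -> exists z, [/\ z < n, s (neighbor x v) = neighbor z (s v),
    (x < j.+1.*2 -> z = x) & (j.+1.*2 <= x -> j.+1.*2 <= z)].
  move=> xn; have [f [injf cf fE]] := aut_neighbor s v sP.
  have rigid (y : 'I_n) : y < j.+1.*2 -> f y = y.
    by apply: square_dims_rigid => //; lia.
  exists (f (Ordinal xn)); split=> //; first exact: (fE (Ordinal xn)).
    by move=> xj; rewrite rigid.
  move=> xj; rewrite leqNgt; apply/negP=> lt.
  by move/injf: (rigid _ lt) => e; rewrite e /= in lt; lia.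
have high (z : nat) v : z < n -> j.+1.*2 <= z ->
    (bit (neighbor z v) j.*2 = bit v j.*2) *
    (bit (neighbor z v) j.*2.+1 = bit v j.*2.+1 (+) bit v j.*2).
  move=> zn jz; rewrite bit_neighbor_even // bit_neighbor_odd //.
  have -> : (j.*2 == z) = false by lia.
  have -> : (j.*2.+1 == z) = false by lia.
  have -> : j < z./2 by lia.
  by rewrite !addbF.
have n1 : j.*2 + 1 < n by lia.
have low v : (bit (neighbor (j.*2 + 1) v) j.*2 = bit v j.*2) *
    (bit (neighbor (j.*2 + 1) v) j.*2.+1 = ~~ bit v j.*2.+1).
  rewrite bit_neighbor_even // bit_neighbor_odd //.
  have -> : (j.*2 == j.*2 + 1) = false by lia.
  have -> : (j.*2.+1 == j.*2 + 1) by lia.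
  have -> : (j < (j.*2 + 1)./2) = false by lia.
  by rewrite !addbF addbT.
have := congr1 (fun w => bit (s w) j.*2.+1) (hexagon u j jn uj).
set u1 := neighbor (_ + 4) u; set u2 := neighbor _ u1.
set u3 := neighbor _ u2; set u4 := neighbor _ u3; set u5 := neighbor _ u4.
have [|z6 [lt6 -> _ h6]] := step u5 (j.*2 + 3); first by lia.
have {}h6 : j.+1.*2 <= z6 by apply: h6; lia.
have [|z5 [lt5 -> e5 _]] := step u4 (j.*2 + 1); first by lia.
rewrite {}e5; last by lia.
have [|z4 [lt4 -> _ h4]] := step u3 (j.*2 + 2); first by lia.
have {}h4 : j.+1.*2 <= z4 by apply: h4; lia.
have [|z3 [lt3 -> _ h3]] := step u2 (j.*2 + 4); first by lia.
have {}h3 : j.+1.*2 <= z3 by apply: h3; lia.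
have [|z2 [lt2 -> _ h2]] := step u1 (j.*2 + 2); first by lia.
have {}h2 : j.+1.*2 <= z2 by apply: h2; lia.
have [|z1 [lt1 -> _ h1]] := step u (j.*2 + 4); first by lia.
have {}h1 : j.+1.*2 <= z1 by apply: h1; lia.
(* Along the image walk bit [j.*2] is constant, and bit [j.*2.+1] changes by one flip and five
   copies of it. *)
rewrite (high z6) // !low !(high z4) // !(high z3) // !(high z2) // !(high z1) //.
by case: (bit _ j.*2.+1); case: (bit _ j.*2).
Qed.

Lemma aut_bitE (s : {perm n.-tuple bool}) u j : s \in graph_aut (@CQ n) ->
  j.*2 + 4 < n -> bit (s u) j.*2 = bit u j.*2.
Proof.
move=> sP jn; apply/idP/idP; last exact: aut_bit.
by move/(aut_bit s^-1%g _ _ (groupVr sP) jn); rewrite permK.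
Qed.

(** * Shear automorphisms *)

Hypothesis n3 : 3 <= n.

(** The least even position not covered by [aut_bitE]. As [n <= t + 4], positions [t.+2] and [t.+3]
    form the top pair. *)
Let t := (uphalf n - 2).*2.

(* Flipping bit t changes the action on bit t+1 of the dimensions t+2 and t+3;
   the last summand compensates for this.  Bit t+3 is absent, hence 0, when n
   is odd. *)
Definition shear (c : nat -> bool) u : n.-tuple bool :=
  vertex (fun i => bit u i (+) c i (+)
                   [&& i == t.+1, c t & bit u t.+2 (+) bit u t.+3]).

Section Shear.

Variable c : nat -> bool.
Hypothesis c_default : forall i, n <= i -> c i = false.
Hypothesis c_even : forall k, k.*2 < t -> c k.*2 = false.

Lemma bit_shear u i : bit (shear c u) i =
  bit u i (+) c i (+) [&& i == t.+1, c t & bit u t.+2 (+) bit u t.+3].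
Proof.
case: (ltnP i n) => [|ni]; first exact: bit_vertex.
rewrite !(bit_default _ _ ni) c_default //.
by have -> : (i == t.+1) = false by move: n3; rewrite /t; lia.
Qed.

Lemma shear_neighbor u x : x < n ->
  shear c (neighbor x u) = neighbor x (shear c u).
Proof.
move=> xn; apply: bit_inj => i.
(* No dimension lies above the top pair, so the sum of its bits changes exactly when [x] belongs to
   it. *)
have tE : (bit (neighbor x u) t.+2 (+) bit (neighbor x u) t.+3) =
    (bit u t.+2 (+) bit u t.+3) (+) (t./2.+1 == x./2).
  rewrite /t -!doubleS bit_neighbor_even // bit_neighbor_odd // doubleK.
  have -> : ((uphalf n - 2).+1 < x./2) = false by lia.
  have -> : ((uphalf n - 2).+1 == x./2) =
    ((uphalf n - 2).+1.*2 == x) (+) ((uphalf n - 2).+1.*2.+1 == x) by lia.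
  by case: bit; case: bit; case: eqP; case: eqP.
rewrite bit_shear tE; rewrite -(odd_double_half i); move: (i./2) => k.
have -> : odd i + k.*2 = if odd i then k.*2.+1 else k.*2 by case: odd.
case: odd; rewrite ?bit_neighbor_odd // ?bit_neighbor_even // !bit_shear.
  have -> : (k.*2 == t.+1) = false by lia.
  have [kt|kt|kt] := ltngtP k.*2 t.
  - rewrite (c_even k kt).
    have -> : (k.*2.+1 == t.+1) = false by lia.
    by rewrite !addbF; case: bit; case: bit; case: c; case: eqP; case: ltnP.
  - have -> : (k.*2.+1 == t.+1) = false by lia.
    have -> : (k < x./2) = false by lia.
    by rewrite !addbF; case: bit; case: c; case: eqP.
  (* A step in the top pair adds bit [t], now shifted by [c t], to bit [t.+1]; the correction
     changes by [c t] as well. *)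
  rewrite kt eqxx.
  have -> : (t./2.+1 == x./2) = (k < x./2) by lia.
  by do 4!case: bit; case: c; case: c; case: eqP; case: ltnP.
have -> : (k.*2 == t.+1) = false by lia.
by rewrite !addbF; case: bit; case: c; case: eqP.
Qed.

(** The correction reads only positions [t.+2] and [t.+3], where the shear merely adds [c]. *)
Lemma shear_inj : injective (shear c).
Proof.
move=> u v e; have E i := congr1 (fun w => bit w i) e.
have off i : i != t.+1 -> bit u i = bit v i.
  move=> /negbTE it; have := E i; rewrite !bit_shear it !addbF.
  exact: addIb.
apply: bit_inj => i; have := E i; rewrite !bit_shear !(off t.+2) ?(off t.+3).
- by move/addIb/addIb.
- by lia.
- by lia.
Qed.

Lemma shear_aut : perm shear_inj \in graph_aut (@CQ n).
Proof.
apply/graph_autP => u v; rewrite !permE; apply/CQP/CQP => -[x xn e]; exists x => //.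
  by apply: shear_inj; rewrite shear_neighbor.
by rewrite e shear_neighbor.
Qed.

End Shear.

(** * Orbits and their number *)

Lemma mem_orbit_CQ u v :
  (v \in orbit 'P (graph_aut (@CQ n)) u) =
  [forall j : 'I_(uphalf n - 2), bit v j.*2 == bit u j.*2].
Proof.
apply/orbitP/forallP => [[s sP <-] j|uv].
  by rewrite /= apermE aut_bitE //; have := ltn_ord j; lia.
(* The solution of [shear c u = v], with [c t] inside the correction replaced by its value. *)
pose c i := bit u i (+) bit v i (+)
  [&& i == t.+1, bit u t (+) bit v t & bit u t.+2 (+) bit u t.+3].
have c_default i : n <= i -> c i = false.
  move=> ni; rewrite /c !(bit_default _ _ ni).
  by have -> : (i == t.+1) = false by move: n3; rewrite /t; lia.
have c_even k : k.*2 < t -> c k.*2 = false.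
  rewrite ltn_double => kt; have /eqP := uv (Ordinal kt).
  rewrite /c /= => ->; have -> : (k.*2 == t.+1) = false by rewrite /t; lia.
  by rewrite addbb.
have ct : c t = bit u t (+) bit v t.
  rewrite /c; have -> : (t == t.+1) = false by lia.
  by rewrite addbF.
exists (perm (shear_inj c c_default)); first exact: shear_aut.
rewrite /= apermE permE; apply: bit_inj => i; rewrite bit_shear // ct /c.
by case: (bit u i); case: (bit v i); case: (_ && _).
Qed.

Lemma Orb_CQ : Orb (@CQ n) = 2 ^ (uphalf n - 2).
Proof.
pose m := uphalf n - 2.
(* One representative for each choice of the invariant bits, zero elsewhere; [insub] fails on pairs
   beyond the range. *)
pose rep (c : {ffun 'I_m -> bool}) : n.-tuple bool :=
  vertex (fun i => if insub i./2 is Some j then ~~ odd i && c j else false).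
have bit_rep c (j : 'I_m) : bit (rep c) j.*2 = c j.
  rewrite bit_vertex; last by have := ltn_ord j; rewrite /m; lia.
  by rewrite doubleK valK odd_double.
pose orb c := orbit 'P (graph_aut (@CQ n)) (rep c).
have orb_inj : injective orb.
  move=> c d e; have := orbit_refl 'P (graph_aut (@CQ n)) (rep c).
  rewrite -/(orb c) e mem_orbit_CQ => /forallP cd; apply/ffunP => j.
  by have /eqP := cd j; rewrite !bit_rep.
rewrite /Orb.
suff -> : orbit 'P (graph_aut (@CQ n)) @: [set: n.-tuple bool] = orb @: setT.
  by rewrite card_imset // cardsT card_ffun card_bool card_ord.
apply/setP => O; apply/imsetP/imsetP => [[u _ ->]|[c _ ->]]; last by exists (rep c).
exists [ffun j : 'I_m => bit u j.*2] => //; apply/orbit_eqP.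
by rewrite mem_orbit_CQ; apply/forallP => j; rewrite bit_rep ffunE.
Qed.

End CrossedCube.

Theorem theorem2 (n : nat) (hn : 3 <= n) :
  Orb (@CQ n) = 2 ^ (uphalf n - 2).
Proof. exact: Orb_CQ. Qed.
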